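(* For every positive integer $t$: (1) $|R_{4t}|=2^{t-1}$; (2) $|R_{\le 4t}|=2^t-1$.
   Context: $G=\mathbb{Z}_2*\mathbb{Z}_3$, where $a$ generates $\mathbb{Z}_2$ and $b$ generates $\mathbb{Z}_3$. The word length $\|g\|$ of $g\in G$ is the minimum length of a word in $\{a,b,b^{-1}\}$ representing $g$; the length of a conjugacy class is $\|[g]\|=\min\{\|h\|:h\in[g]\}$. The set of reciprocal words is $\mathcal{R}=\{xy: x,y\text{ distinct order 2 elements of }G\}$, which is conjugacy invariant; $R$ is the set of conjugacy classes of $\mathcal{R}$, and $R_n$, $R_{\le n}$ denote the classes in $R$ of length $n$, respectively at most $n$. *)

(* Defs.v *)
From HB Require Import structures.
From mathcomp Require Import all_boot all_algebra all_fingroup.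
From mathcomp Require Import boolp classical_sets functions cardinality.

Set Implicit Arguments.
Unset Strict Implicit.
Unset Printing Implicit Defensive.

Local Open Scope classical_set_scope.
Local Open Scope group_scope.

(* The free product of two groups, realised on its normal forms: a word over  *)
(* the disjoint union of the factors is reduced when no letter is trivial and *)
(* neighbouring letters come from different factors. The lemmas fp_lift_inl,  *)
(* fp_lift_inr, fp_liftM and fp_lift_uniq give the universal property of the  *)
(* coproduct of groups.                                                       *)
Section FreeProduct.
Variables G1 G2 : groupType.
Implicit Types (x y : G1 + G2) (w : seq (G1 + G2)).

Definition fp_triv x := match x with inl g => g == 1 | inr g => g == 1 end.

Definition fp_alt x y :=
  match x, y with inl _, inr _ | inr _, inl _ => true | _, _ => false end.

Definition fp_reduced w := all (predC fp_triv) w && sorted fp_alt w.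

Record free_product := FreeProduct {
  fp_word :> seq (G1 + G2);
  fp_wordP : fp_reduced fp_word }.

HB.instance Definition _ := [isSub for fp_word].
HB.instance Definition _ := [Choice of free_product by <:].

Definition fp_push x w := if fp_triv x then w else x :: w.

(* The normal form of the product of the letter x with the reduced word w.    *)
Definition fp_cons x w :=
  match x, w with
  | inl g, inl h :: w' => fp_push (inl (g * h)) w'
  | inr g, inr h :: w' => fp_push (inr (g * h)) w'
  | _, _ => fp_push x w
  end.

Definition fp_mulw w1 w2 := foldr fp_cons w2 w1.

Definition fp_invl x : G1 + G2 :=
  match x with inl g => inl g^-1 | inr g => inr g^-1 end.

Definition fp_invw w := rev (map fp_invl w).

Lemma fp_reduced_cons x w :
  fp_reduced (x :: w) =
  [&& ~~ fp_triv x, (w != [::]) ==> fp_alt x (head x w) & fp_reduced w].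
Proof.
rewrite /fp_reduced /=; case: w => [|y w] /=; first by rewrite !andbT.
by case: (fp_triv x); case: (fp_triv y); case: (fp_alt x y); rewrite ?andbF.
Qed.

Definition fp_notl w := if w is inl _ :: _ then false else true.
Definition fp_notr w := if w is inr _ :: _ then false else true.

Lemma fp_splitl w : fp_reduced w ->
  exists g w', [/\ w = fp_push (inl g) w', fp_notl w' & fp_reduced w'].
Proof.
case: w => [|[g|g] w] rw; try by exists 1, [::]; rewrite /fp_push /= eqxx.
- move: (rw); rewrite fp_reduced_cons => /and3P[/= g1 hw rw'].
  exists g, w; rewrite /fp_push /= (negPf g1); split=> //.
  by case: w hw {rw rw'} => [|[]].
- by exists 1, (inr g :: w); rewrite /fp_push /= eqxx.
Qed.

Lemma fp_splitr w : fp_reduced w ->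
  exists g w', [/\ w = fp_push (inr g) w', fp_notr w' & fp_reduced w'].
Proof.
case: w => [|[g|g] w] rw; try by exists 1, [::]; rewrite /fp_push /= eqxx.
- by exists 1, (inl g :: w); rewrite /fp_push /= eqxx.
- move: (rw); rewrite fp_reduced_cons => /and3P[/= g1 hw rw'].
  exists g, w; rewrite /fp_push /= (negPf g1); split=> //.
  by case: w hw {rw rw'} => [|[]].
Qed.

Lemma fp_cons_pushl (g h : G1) w : fp_notl w ->
  fp_cons (inl g) (fp_push (inl h) w) = fp_push (inl (g * h)) w.
Proof.
move=> nw; rewrite {1}/fp_push /=; case: eqP => [->|//].
by rewrite mulg1; case: w nw => [|[]].
Qed.

Lemma fp_cons_pushr (g h : G2) w : fp_notr w ->
  fp_cons (inr g) (fp_push (inr h) w) = fp_push (inr (g * h)) w.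
Proof.
move=> nw; rewrite {1}/fp_push /=; case: eqP => [->|//].
by rewrite mulg1; case: w nw => [|[]].
Qed.

Lemma fp_pushl_reduced (g : G1) w :
  fp_notl w -> fp_reduced w -> fp_reduced (fp_push (inl g) w).
Proof.
rewrite /fp_push /=; case: ifP => // g1 nw rw.
by rewrite fp_reduced_cons /= g1 rw andbT; case: w nw {rw} => [|[]].
Qed.

Lemma fp_pushr_reduced (g : G2) w :
  fp_notr w -> fp_reduced w -> fp_reduced (fp_push (inr g) w).
Proof.
rewrite /fp_push /=; case: ifP => // g1 nw rw.
by rewrite fp_reduced_cons /= g1 rw andbT; case: w nw {rw} => [|[]].
Qed.

Lemma fp_cons_reduced x w : fp_reduced w -> fp_reduced (fp_cons x w).
Proof.
case: x => g rw.
- have [h [w' [-> nw rw']]] := fp_splitl rw.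
  by rewrite fp_cons_pushl // fp_pushl_reduced.
- have [h [w' [-> nw rw']]] := fp_splitr rw.
  by rewrite fp_cons_pushr // fp_pushr_reduced.
Qed.

Lemma fp_consMl (g h : G1) w : fp_reduced w ->
  fp_cons (inl g) (fp_cons (inl h) w) = fp_cons (inl (g * h)) w.
Proof.
by move=> /fp_splitl[k [w' [-> nw rw]]]; rewrite !fp_cons_pushl // mulgA.
Qed.

Lemma fp_consMr (g h : G2) w : fp_reduced w ->
  fp_cons (inr g) (fp_cons (inr h) w) = fp_cons (inr (g * h)) w.
Proof.
by move=> /fp_splitr[k [w' [-> nw rw]]]; rewrite !fp_cons_pushr // mulgA.
Qed.

Lemma fp_cons1 x w : fp_reduced w -> fp_triv x -> fp_cons x w = w.
Proof.
case: x => g rw /eqP->.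
- by have [k [w' [-> nw _]]] := fp_splitl rw; rewrite fp_cons_pushl // mul1g.
- by have [k [w' [-> nw _]]] := fp_splitr rw; rewrite fp_cons_pushr // mul1g.
Qed.

Lemma fp_consE x w : fp_reduced (x :: w) -> fp_cons x w = x :: w.
Proof.
rewrite fp_reduced_cons => /and3P[/negPf tx hw _].
by case: x w tx hw => g [|[] h w] //= tx _; rewrite /fp_push /= tx.
Qed.

Lemma fp_mulw_reduced w1 w2 : fp_reduced w2 -> fp_reduced (fp_mulw w1 w2).
Proof. by move=> r2; elim: w1 => //= x w1; apply: fp_cons_reduced. Qed.

Lemma fp_mulw_cons x w1 w2 : fp_reduced w1 -> fp_reduced w2 ->
  fp_mulw (fp_cons x w1) w2 = fp_cons x (fp_mulw w1 w2).
Proof.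
move=> r1 r2; have rr w := fp_mulw_reduced w r2.
have pushE y w : fp_mulw (fp_push y w) w2 = fp_cons y (fp_mulw w w2).
  by rewrite /fp_push; case: ifP => //= ty; rewrite fp_cons1.
case: x => g.
- have [h [w' [-> nw _]]] := fp_splitl r1.
  by rewrite fp_cons_pushl // !pushE fp_consMl.
- have [h [w' [-> nw _]]] := fp_splitr r1.
  by rewrite fp_cons_pushr // !pushE fp_consMr.
Qed.

Lemma fp_mulwA w1 w2 w3 : fp_reduced w2 -> fp_reduced w3 ->
  fp_mulw w1 (fp_mulw w2 w3) = fp_mulw (fp_mulw w1 w2) w3.
Proof.
move=> r2 r3; elim: w1 => //= x w1 ->.
by rewrite fp_mulw_cons // fp_mulw_reduced.
Qed.

Lemma fp_mulw0 w : fp_reduced w -> fp_mulw w [::] = w.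
Proof.
elim: w => //= x w IHw rxw; have := rxw.
by rewrite fp_reduced_cons => /and3P[_ _ /IHw->]; apply: fp_consE.
Qed.

Lemma fp_invw_reduced w : fp_reduced w -> fp_reduced (fp_invw w).
Proof.
case/andP=> tw sw; apply/andP; split.
  rewrite all_rev all_map; apply: sub_all tw => -[] g /=;
  by rewrite -(inj_eq invg_inj) invg1.
rewrite rev_sorted sorted_map; apply: sub_sorted sw.
by case=> g [].
Qed.

Lemma fp_cons_invl x w : fp_reduced w -> fp_cons (fp_invl x) (fp_cons x w) = w.
Proof.
move=> rw; rewrite /fp_invl; case: x => g.
- by rewrite fp_consMl // mulVg fp_cons1 //=.
- by rewrite fp_consMr // mulVg fp_cons1 //=.
Qed.

Lemma fp_mulVw w : fp_reduced w -> fp_mulw (fp_invw w) w = [::].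
Proof.
rewrite /fp_invw /fp_mulw; elim: w => //= x w IHw rw.
have rw' : fp_reduced w by move: rw; rewrite fp_reduced_cons => /and3P[].
by rewrite rev_cons foldr_rcons -(fp_consE rw) fp_cons_invl // IHw.
Qed.

Lemma fp_invwK : involutive fp_invw.
Proof.
move=> w; rewrite /fp_invw map_rev revK -map_comp map_id_in //.
by case=> g _ /=; rewrite invgK.
Qed.

Lemma fp_mulwV w : fp_reduced w -> fp_mulw w (fp_invw w) = [::].
Proof.
by move=> rw; rewrite -{1}[w]fp_invwK fp_mulVw ?fp_invw_reduced.
Qed.

Definition fp_one := @FreeProduct [::] isT.
Definition fp_mul (u v : free_product) :=
  FreeProduct (fp_mulw_reduced u (fp_wordP v)).
Definition fp_inv (u : free_product) :=
  FreeProduct (fp_invw_reduced (fp_wordP u)).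

Lemma fp_mulA : associative fp_mul.
Proof. by move=> u v w; apply/val_inj/fp_mulwA; apply: fp_wordP. Qed.
Lemma fp_mul1 : left_id fp_one fp_mul.
Proof. by move=> u; apply: val_inj. Qed.
Lemma fp_mulr1 : right_id fp_one fp_mul.
Proof. by move=> u; apply/val_inj/fp_mulw0/fp_wordP. Qed.
Lemma fp_mulV : left_inverse fp_one fp_inv fp_mul.
Proof. by move=> u; apply/val_inj/fp_mulVw/fp_wordP. Qed.
Lemma fp_mulrV : right_inverse fp_one fp_inv fp_mul.
Proof. by move=> u; apply/val_inj/fp_mulwV/fp_wordP. Qed.

HB.instance Definition _ :=
  isGroup.Build free_product fp_mulA fp_mul1 fp_mulr1 fp_mulV fp_mulrV.

Lemma fp_letter_reduced x : fp_reduced (fp_push x [::]).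
Proof. by rewrite /fp_push; case: ifP => // tx; rewrite /fp_reduced /= tx. Qed.

Definition fp_inl (g : G1) := FreeProduct (fp_letter_reduced (inl g)).
Definition fp_inr (g : G2) := FreeProduct (fp_letter_reduced (inr g)).

Lemma fp_val_inl g (u : free_product) : val (fp_inl g * u) = fp_cons (inl g) u.
Proof.
change (fp_mulw (fp_push (inl g) [::]) u = fp_cons (inl g) u).
by rewrite /fp_push; case: ifP => // tg; rewrite fp_cons1 // fp_wordP.
Qed.

Lemma fp_val_inr g (u : free_product) : val (fp_inr g * u) = fp_cons (inr g) u.
Proof.
change (fp_mulw (fp_push (inr g) [::]) u = fp_cons (inr g) u).
by rewrite /fp_push; case: ifP => // tg; rewrite fp_cons1 // fp_wordP.
Qed.

Lemma fp_inlM : {morph fp_inl : g h / g * h}.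
Proof.
by move=> g h; apply: val_inj; rewrite fp_val_inl fp_cons_pushl.
Qed.

Lemma fp_inrM : {morph fp_inr : g h / g * h}.
Proof.
by move=> g h; apply: val_inj; rewrite fp_val_inr fp_cons_pushr.
Qed.

Lemma fp_prodE (u : free_product) :
  u = \prod_(x <- u) match x with inl g => fp_inl g | inr g => fp_inr g end.
Proof.
case: u => w rw; apply: val_inj => /=.
elim: w rw => [|x w IHw] rw; first by rewrite big_nil.
have rw' : fp_reduced w by move: rw; rewrite fp_reduced_cons => /and3P[].
rewrite big_cons; case: x rw => g rw.
- by rewrite fp_val_inl -(IHw rw') fp_consE.
- by rewrite fp_val_inr -(IHw rw') fp_consE.
Qed.

Section Universal.
Variables (H : groupType) (f1 : G1 -> H) (f2 : G2 -> H).
Hypotheses (f1M : {morph f1 : g h / g * h}) (f2M : {morph f2 : g h / g * h}).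

Definition fp_lift (u : free_product) : H :=
  \prod_(x <- u) match x with inl g => f1 g | inr g => f2 g end.

Let f11 : f1 1 = 1.
Proof. by apply: (mulgI (f1 1)); rewrite -f1M !mulg1. Qed.
Let f21 : f2 1 = 1.
Proof. by apply: (mulgI (f2 1)); rewrite -f2M !mulg1. Qed.

Lemma fp_lift_inl g : fp_lift (fp_inl g) = f1 g.
Proof.
rewrite /fp_lift /= /fp_push /=; case: eqP => [->|_].
  by rewrite big_nil f11.
by rewrite big_seq1.
Qed.

Lemma fp_lift_inr g : fp_lift (fp_inr g) = f2 g.
Proof.
rewrite /fp_lift /= /fp_push /=; case: eqP => [->|_].
  by rewrite big_nil f21.
by rewrite big_seq1.
Qed.

Lemma fp_liftM : {morph fp_lift : u v / u * v}.
Proof.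
pose F x := match x with inl g => f1 g | inr g => f2 g end.
have pushE x w : \prod_(y <- fp_push x w) F y = F x * \prod_(y <- w) F y.
  rewrite /fp_push; case: ifP => [|_]; last by rewrite big_cons.
  by case: x => g /= /eqP->; rewrite ?f11 ?f21 mul1g.
have consE x w : \prod_(y <- fp_cons x w) F y = F x * \prod_(y <- w) F y.
  by case: x w => g [|[] h w];
    rewrite /fp_cons pushE ?big_cons //= ?f1M ?f2M mulgA.
case=> [u ru] [v rv]; rewrite /fp_lift /= -/F.
elim: u {ru} => [|x u IHu]; first by rewrite big_nil mul1g.
by rewrite /= consE IHu big_cons mulgA.
Qed.

Lemma fp_lift_uniq (f : free_product -> H) :
  {morph f : u v / u * v} -> (forall g, f (fp_inl g) = f1 g) ->
  (forall g, f (fp_inr g) = f2 g) -> f =1 fp_lift.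
Proof.
move=> fM fl fr u; rewrite [u in LHS]fp_prodE (big_morph f fM (id1 := 1)).
  by apply: eq_bigr => -[] g _.
by apply: (mulgI (f 1)); rewrite -fM !mulg1.
Qed.
End Universal.
End FreeProduct.

Definition has_order (G : groupType) (g : G) (n : nat) :=
  [/\ (0 < n)%N, g ^+ n = 1 & forall m, (0 < m < n)%N -> g ^+ m <> 1].

Definition conj_class (G : groupType) (g : G) : set G := range (conjg g).

(* The junk value 0 is returned only on the empty set (see min_natP); the     *)
(* sets to which it is applied below are nonempty by word_length_ex and       *)
(* conj_class_neq0.                                                           *)
Definition min_nat (A : set nat) : nat :=
  xget 0%N [set n | A n /\ forall m, A m -> (n <= m)%N].

Lemma min_natP (A : set nat) : A !=set0 ->
  A (min_nat A) /\ forall m, A m -> (min_nat A <= m)%N.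
Proof.
case=> n An; rewrite /min_nat; case: xgetP => [m _ //|].
have exA : exists k, `[< A k >] by exists n; apply/asboolP.
case: (ex_minnP exA) => k /asboolP Ak kmin /(_ k)[].
by split=> // m Am; apply/kmin/asboolP.
Qed.

(* The groups 'Z_2 and 'Z_3 are the finGroupTypes of integers modulo 2 and 3  *)
(* (under addition); 1%R is the standard generator.                           *)
Definition G : groupType := free_product 'Z_2 'Z_3.
Definition a : G := fp_inl 'Z_3 (1%R : 'Z_2).
Definition b : G := fp_inr 'Z_2 (1%R : 'Z_3).

Definition word_length (g : G) : nat :=
  min_nat [set size w | w in [set w : seq G |
    {subset w <= [:: a; b; b^-1]} /\ \prod_(x <- w) x = g]].

Definition class_length (C : set G) : nat := min_nat (word_length @` C).

Definition reciprocal : set G :=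
  [set g | exists x y : G,
    [/\ x <> y, has_order x 2, has_order y 2 & g = x * y]].

Definition R_classes : set (set G) := @conj_class G @` reciprocal.

Definition R_eq (n : nat) : set (set G) :=
  [set C | R_classes C /\ class_length C = n].

Definition R_le (n : nat) : set (set G) :=
  [set C | R_classes C /\ (class_length C <= n)%N].

Lemma a_order : has_order a 2.
Proof. by split=> [//||[|[|m]] //]; apply: val_inj. Qed.

Lemma b_order : has_order b 3.
Proof. by split=> [//||[|[|[|m]]] //]; apply: val_inj. Qed.

Lemma conj_class_neq0 (g : G) : conj_class g !=set0.
Proof. by exists g, 1; rewrite //= conjg1. Qed.

Lemma word_length_ex (g : G) :
  exists2 w : seq G, {subset w <= [:: a; b; b^-1]} & \prod_(x <- w) x = g.
Proof.
have letter (x : 'Z_2 + 'Z_3) : ~~ fp_triv x ->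
    match x with inl h => fp_inl 'Z_3 h | inr h => fp_inr 'Z_2 h end
    \in [:: a; b; b^-1].
  by case: x => -[[|[|[|m]]] lt].
exists [seq match x with inl h => fp_inl 'Z_3 h | inr h => fp_inr 'Z_2 h end
       | x <- fp_word g]; last by rewrite big_map -fp_prodE.
have /andP[/allP tg _] := fp_wordP g.
by move=> x /mapP[y /tg ty ->]; apply: letter.
Qed.

(* Main.v *)
Require Import Defs.
From mathcomp Require Import all_boot all_algebra all_fingroup.
From mathcomp Require Import boolp classical_sets functions cardinality.
From mathcomp Require finmap.
From mathcomp Require Import zify.

(* Every element of order 2 is conjugate to a, so a reciprocal word is        *)
(* conjugate to (k a k^-1) a with k = a b^(e_1) ... a b^(e_n), n > 0, that is *)
(* to the cyclically reduced word whose exponents of b are the                *)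
(* antipalindrome e_1, ..., e_n, -e_n, ..., -e_1; its class has length 4n.    *)
(* Two such words are conjugate iff their exponent sequences are rotations of *)
(* each other, and the rotation class of an antipalindrome contains exactly   *)
(* two antipalindromes. So there are 2^n / 2 classes of length 4n.            *)

(** The outline above is carried as follows. [R_classesE] replaces reciprocal classes by those of
    [ab_prod (antipal s)], using [involution_conj_a]. [ab_prod_conj] turns conjugacy into rotation
    of boolean words, and [class_length_ab_prod] makes the length twice the size of the word.
    Antipalindromes are the fixed points of a reflection (reverse and negate) that inverts the
    rotation by one step, so [card_fixed_orbits] counts their necklaces: half of the 2^n
    antipalindromes. As all lengths are positive multiples of 4, summing over n gives the second
    claim. *)

Set Implicit Arguments.
Unset Strict Implicit.
Unset Printing Implicit Defensive.

(** * Rotation classes of antipalindromes *)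

(* For f a rotation and r a reflection, the hypothesis says that r inverts f. *)
(* An orbit through a fixed point x of r then has even period 2m (at an odd   *)
(* period 2m+1, the point f^m x would satisfy r y = f y), and f^i x is fixed  *)
(* by r iff 2m divides 2i, that is for exactly two points of the orbit.       *)
Lemma card_fixed_orbits (T : finType) (f r : T -> T) :
  injective f -> (forall x, f (r (f x)) = r x) -> (forall x, r x != f x) ->
  #|[set x | r x == x]| = (2 * #|froot f @: [set x | r x == x]|)%N.
Proof.
move=> f_inj frf r_f; set X := [set x | _].
have fn_inj n : injective (iter n f).
  by elim: n => // n IHn x y /= /f_inj /IHn.
have iterr n x : iter n f (r (iter n f x)) = r x.
  by elim: n => // n IHn; rewrite iterSr (iterS n f x) frf.
have fixE x : (x \in X) = (r x == x) by rewrite inE.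
have fiber x : x \in X -> #|[set y in X | froot f y == froot f x]| = 2.
  rewrite fixE => /eqP rx; have [m pE] : exists m, fingraph.order f x = m.*2.
    exists (fingraph.order f x)./2; have := odd_double_half (fingraph.order f x).
    case: (boolP (odd _)) => // _; rewrite add1n; set m := _./2 => pE.
    have /eqP[] := r_f (iter m f x).
    by apply: (fn_inj m); rewrite iterr rx -iterS -iterD addnS addnn pE iter_order.
  have m_gt0 : (0 < m)%N by have := fingraph.order_gt0 f x; rewrite pE double_gt0.
  have per i : (i < m.*2)%N -> iter i f x = x -> i = 0%N.
    by move=> lt ex; rewrite -(@findex_iter _ f x i) ?pE // ex findex0.
  have xm : x != iter m f x.
    by apply/eqP => /esym xm; have := per m _ xm; lia.
  have <- : #|[set x; iter m f x]| = 2 by rewrite cards2 xm.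
  apply: eq_card => y.
  rewrite !inE root_connect; last exact: fconnect_sym.
  rewrite fconnect_sym //; apply/andP/orP => [[/eqP ry xy]|].
    (* Write y = f^i x with i < 2m. Since x and y are fixed by r, f^(2i) x = x; hence 2i = 0 or 2i =
       2m. *)
    have := iter_findex xy; have := findex_max xy; rewrite pE.
    set i := findex f x y => lt ey; have := iterr i x.
    rewrite ey ry rx -ey -iterD addnn => xi.
    have [lt'|ge] := ltnP i.*2 m.*2.
      by move/per: xi => /(_ lt')/eqP; rewrite double_eq0 => /eqP->; left.
    right; suff /eqP: (i.*2 - m.*2 = 0)%N.
      rewrite subn_eq0 leq_double => le; apply/eqP; congr (iter _ f x).
      by apply/eqP; rewrite eqn_leq le -leq_double.
    apply: per; first by rewrite ltn_subLR // -doubleD ltn_double; move: lt; lia.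
    by rewrite -[in LHS](iter_order f_inj x) pE -iterD subnK.
  case=> /eqP->; first by rewrite rx connect0.
  split; last exact: fconnect_iter.
  apply/eqP/(fn_inj m); rewrite iterr rx -iterD addnn -pE.
  by rewrite iter_order.
rewrite -sum1_card (partition_big_imset (froot f)) /= mulnC -sum_nat_const.
by apply: eq_bigr => _ /imsetP[x xX ->]; rewrite -(fiber x xX) sum1dep_card.
Qed.

Definition rot1_tuple n (t : n.-tuple bool) : n.-tuple bool := [tuple of rot 1 t].
Definition rev_negb_tuple n (t : n.-tuple bool) : n.-tuple bool :=
  [tuple of rev (map negb t)].

Lemma rot1_tuple_inj n : injective (@rot1_tuple n).
Proof. by move=> t u /(congr1 val) /= /rot_inj /val_inj. Qed.

Lemma fconnect_rot1_tuple n (t u : n.-tuple bool) :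
  fconnect (@rot1_tuple n) t u <-> exists m, u = rot m t :> seq bool.
Proof.
split=> [/iter_findex <-|[m um]].
  elim: (findex _ _ _) => [|i [m IHm]] /=; first by exists 0%N; rewrite rot0.
  rewrite IHm; have [le|gt] := leqP (size t) m; last by exists m.+1; rewrite (rotS gt).
  by exists 1%N; rewrite (rot_oversize le).
have [le|gt] := leqP (size t) m.
  by move: um; rewrite rot_oversize // => /val_inj ->; apply: connect0.
suff -> : u = iter m (@rot1_tuple n) t by apply: fconnect_iter.
apply: val_inj; rewrite /= um; elim: m gt {um} => [|m IHm] gt; first by rewrite rot0.
by rewrite rotS ?IHm // ltnW.
Qed.

Lemma rot1_rev_negb n (t : n.-tuple bool) :
  rot1_tuple (rev_negb_tuple (rot1_tuple t)) = rev_negb_tuple t.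
Proof.
apply: val_inj => /=; case: (val t) => //= x s.
by rewrite rot1_cons map_rcons rev_rcons rot1_cons rev_cons.
Qed.

(** The last entries differ: both come from the first entry of [t], which is negated on one side
    only. This is what excludes orbits of odd period. *)
Lemma rev_negb_neq_rot1 n (t : n.-tuple bool) :
  (0 < n)%N -> rev_negb_tuple t != rot1_tuple t.
Proof.
move=> n0; apply/eqP => /(congr1 val) /=.
case: t => -[|x s] /= sz; first by rewrite -(eqP sz) in n0.
by rewrite rot1_cons rev_cons => /rcons_inj[_]; case: x.
Qed.

Definition antipal_tuple k (t : k.-tuple bool) : (k + k).-tuple bool :=
  [tuple of t ++ rev (map negb t)].

Lemma antipal_tuple_inj k : injective (@antipal_tuple k).
Proof.
move=> t u /(congr1 (take k \o val)) /=.
by rewrite !take_size_cat ?size_tuple // => /val_inj.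
Qed.

Lemma rev_negb_fixedE k :
  [set t | @rev_negb_tuple (k + k) t == t] = [set antipal_tuple t | t : k.-tuple bool].
Proof.
apply/setP => t; rewrite inE; apply/eqP/imsetP => [/(congr1 val) /= et|[u _ ->]].
  have sz : size (take k t) == k by rewrite size_takel // size_tuple leq_addr.
  exists (Tuple sz) => //; apply: val_inj => /=.
  rewrite -[LHS](cat_take_drop k); congr (_ ++ _).
  by rewrite -[in LHS]et drop_rev size_map size_tuple addnK map_take.
apply: val_inj; rewrite /= map_cat rev_cat map_rev revK -map_comp.
by rewrite map_id_in // => x _ /=; rewrite negbK.
Qed.

(** One representative per rotation class that contains an antipalindrome; the representative chosen
    by [froot] need not be an antipalindrome itself. *)
Definition antipal_necklaces k : {set (k + k).-tuple bool} :=
  froot (@rot1_tuple (k + k)) @: [set t | rev_negb_tuple t == t].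

(** An antipalindrome is determined by its free first half, so there are 2^k of them, two in each
    class. *)
Lemma card_antipal_necklaces k : (0 < k)%N -> #|antipal_necklaces k| = (2 ^ (k - 1))%N.
Proof.
move=> k0; apply/eqP; rewrite -(@eqn_pmul2l 2) // -expnS subn1 prednK //.
rewrite -card_fixed_orbits; last 3 first.
- exact: rot1_tuple_inj.
- exact: rot1_rev_negb.
- by move=> t; apply: rev_negb_neq_rot1; rewrite addn_gt0 k0.
rewrite rev_negb_fixedE card_imset; last exact: antipal_tuple_inj.
by rewrite card_tuple card_bool.
Qed.

Local Open Scope classical_set_scope.
Local Open Scope group_scope.

(** * Normal forms in the free product *)

(** The group law of ['Z_3] is addition: here [1%R] is the generator, whereas the [1] of the group
    scope is the residue 0. *)
Definition b_sign (x : bool) : 'Z_3 := if x then 1%R else (-1)%R.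

Lemma b_signN x : b_sign (~~ x) = (b_sign x)^-1.
Proof. by apply: val_inj; case: x. Qed.

Lemma b_signP (z : 'Z_3) : z = 1 \/ exists x, z = b_sign x.
Proof.
case: z => -[|[|[|m]]] lt //.
- by left; apply: val_inj.
- by right; exists true; apply: val_inj.
- by right; exists false; apply: val_inj.
Qed.

Lemma b_sign_inj : injective b_sign.
Proof. by case=> -[]. Qed.

Lemma Z2_cases (z : 'Z_2) : z = 1 \/ z = 1%R.
Proof. by case: z => -[|[|m]] lt //; [left|right]; apply: val_inj. Qed.

Lemma mulaa : a * a = 1.
Proof. by have [_ + _] := a_order; rewrite expgS expg1. Qed.

Lemma inva : a^-1 = a.
Proof. by apply: (mulgI a); rewrite mulgV mulaa. Qed.

(* s encodes the word a b^(e_1) a b^(e_2) ... with e_i = 1 for true and -1    *)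
(* for false; it is cyclically reduced.                                       *)
Definition ab_prod (s : seq bool) : G :=
  \prod_(x <- s) (a * fp_inr 'Z_2 (b_sign x)).

Definition ab_word (s : seq bool) : seq ('Z_2 + 'Z_3) :=
  flatten [seq [:: inl 1%R; inr (b_sign x)] | x <- s].

Lemma size_ab_word s : size (ab_word s) = (2 * size s)%N.
Proof. by elim: s => //= x s ->; rewrite mulnS. Qed.

Lemma ab_prod_cons x s :
  ab_prod (x :: s) = a * (fp_inr 'Z_2 (b_sign x) * ab_prod s).
Proof. by rewrite /ab_prod big_cons mulgA. Qed.

Lemma ab_prod_cat s s' : ab_prod (s ++ s') = ab_prod s * ab_prod s'.
Proof. exact: big_cat. Qed.

Lemma ab_prodX s n : ab_prod s ^+ n = ab_prod (flatten (nseq n s)).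
Proof.
elim: n => [|n IHn]; first by rewrite /ab_prod big_nil.
by rewrite expgS IHn /= ab_prod_cat.
Qed.

Lemma fp_word_ab_prod s : fp_word (ab_prod s) = ab_word s.
Proof.
elim: s => [|x s IHs]; first by rewrite /ab_prod big_nil.
rewrite ab_prod_cons fp_val_inl fp_val_inr IHs.
by case: s {IHs} => [|y s]; case: x.
Qed.

Lemma fp_word_ab_prod_a s : fp_word (ab_prod s * a) = rcons (ab_word s) (inl 1%R).
Proof.
elim: s => [|x s IHs]; first by rewrite /ab_prod big_nil mul1g.
rewrite ab_prod_cons -!mulgA fp_val_inl fp_val_inr IHs.
by case: s {IHs} => [|y s]; case: x.
Qed.

Lemma ab_prod_inj : injective ab_prod.
Proof.
move=> s s' /(congr1 (@fp_word _ _)); rewrite !fp_word_ab_prod.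
by elim: s s' => [|x s IHs] [|y s'] //= [/b_sign_inj-> /IHs->].
Qed.

Lemma fp_inl1 : fp_inl 'Z_3 (1 : 'Z_2) = 1 :> G.
Proof. exact: val_inj. Qed.

Lemma fp_inr1 : fp_inr 'Z_2 (1 : 'Z_3) = 1 :> G.
Proof. exact: val_inj. Qed.

Lemma ab_normal_form (g : G) : exists z s z',
  g = fp_inr 'Z_2 z * (ab_prod s * fp_inl 'Z_3 z').
Proof.
rewrite [g]fp_prodE; elim: (fp_word g) => [|[h|h] w [z [s [z' IHw]]]].
- by exists 1, [::], 1; rewrite /ab_prod !big_nil fp_inr1 fp_inl1 !mulg1.
- rewrite big_cons IHw; case: (Z2_cases h) => ->.
    by exists z, s, z'; rewrite fp_inl1 mul1g.
  case: (b_signP z) => [->|[x ->]]; last first.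
    by exists 1, (x :: s), z'; rewrite ab_prod_cons fp_inr1 mul1g !mulgA.
  (* The induction forgets that the word is reduced, so the new [a] may meet another [a]: it is
     absorbed by [z'], or cancels the first [a] of [ab_prod s] and exposes a power of [b]. *)
  case: s {IHw} => [|y s].
    exists 1, [::], ((1%R : 'Z_2) * z'); rewrite fp_inlM fp_inr1 /ab_prod big_nil.
    by rewrite !mul1g.
  exists (b_sign y), s, z'; rewrite ab_prod_cons fp_inr1 mul1g -!mulgA.
  by rewrite -/a (mulgA a a) mulaa mul1g.
- by exists (h * z), s, z'; rewrite big_cons IHw fp_inrM !mulgA.
Qed.

(** In the normal form of [ab_normal_form], a nontrivial [z] would make the word start with a power
    of [b], and a nontrivial [z'] would make it end with [a]. *)
Lemma ab_prodP (g : G) x y w w' :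
  fp_word g = inl x :: w -> fp_word g = rcons w' (inr y) ->
  exists s, g = ab_prod s.
Proof.
have [z [s [z' ->]]] := ab_normal_form g; rewrite fp_val_inr.
case: (Z2_cases z') => ->; rewrite ?fp_inl1 ?mulg1 ?fp_word_ab_prod.
  case: (b_signP z) => [->|[e ->]]; last by case: s; case: e.
  by rewrite fp_inr1 mul1g; exists s.
rewrite fp_word_ab_prod_a => _; case: (b_signP z) => [->|[e ->]].
  by rewrite fp_cons1 -?fp_word_ab_prod_a ?fp_wordP// fp_word_ab_prod_a => /rcons_inj[].
have -> : fp_cons (inr (b_sign e)) (rcons (ab_word s) (inl 1%R)) =
    rcons (inr (b_sign e) :: ab_word s) (inl 1%R).
  by case: s; case: e.
by move=> /rcons_inj[].
Qed.

(* Each letter of u cancels or modifies at most one letter of w1, so w2       *)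
(* survives in the normal form of the product.                                *)
Lemma fp_mulw_suffix (G1 G2 : groupType) (u w1 w2 : seq (G1 + G2)) :
  (size u <= size w1)%N ->
  exists2 w1', fp_mulw u (w1 ++ w2) = w1' ++ w2
    & (size w1 <= size w1' + size u)%N.
Proof.
elim: u => [_|x u IHu /= lt]; first by exists w1; rewrite ?addn0.
have [[|y w] /= -> le] := IHu (ltnW lt).
  by move: le; rewrite add0n leqNgt lt.
have pushE z : exists2 w1', fp_push z (w ++ w2) = w1' ++ w2
    & (size w <= size w1')%N.
  by rewrite /fp_push; case: ifP => _; [exists w|exists (z :: w)].
have [z Ez] : exists z, fp_cons x (y :: w ++ w2) = fp_push z (w ++ w2) \/
   fp_cons x (y :: w ++ w2) = fp_push x (y :: w ++ w2).
  by case: x y => g [] h /=; [exists (inl (g * h)); left | exists (inl g); right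
                             |exists (inr g); right | exists (inr (g * h)); left].
case: Ez => ->.
  have [w1' -> le'] := pushE z; exists w1' => //.
  by apply: leq_trans le _; rewrite addSnnS leq_add2r.
rewrite /fp_push; case: ifP => _; [exists (y :: w)|exists (x :: y :: w)] => //=.
  by apply: leq_trans le _; rewrite addnS leqnSn.
by apply: leq_trans le _; rewrite !addSn addnS ltnS leqW.
Qed.

(** * Lengths and conjugacy *)

Lemma size_fp_mulw (G1 G2 : groupType) (w1 w2 : seq (G1 + G2)) :
  (size (fp_mulw w1 w2) <= size w1 + size w2)%N.
Proof.
have pushE x (w : seq (G1 + G2)) : (size (fp_push x w) <= (size w).+1)%N.
  by rewrite /fp_push; case: ifP.
elim: w1 => //= x w1 IHw1; apply: (@leq_trans (size (fp_mulw w1 w2)).+1) => //.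
case: x (fp_mulw w1 w2) => g [|[] h w] /=; rewrite ?pushE //.
  by apply: leq_trans (pushE _ _) _.
by apply: leq_trans (pushE _ _) _.
Qed.

Lemma size_fp_wordM (g h : G) :
  (size (fp_word (g * h)%g) <= size (fp_word g) + size (fp_word h))%N.
Proof. exact: size_fp_mulw. Qed.

Lemma size_fp_wordV (g : G) : size (fp_word g^-1) = size (fp_word g).
Proof. by rewrite size_rev size_map. Qed.

Lemma size_fp_wordX (g : G) n :
  (size (fp_word (g ^+ n)) <= n * size (fp_word g))%N.
Proof.
elim: n => // n IHn; rewrite expgS mulSn.
by apply: leq_trans (size_fp_wordM _ _) _; rewrite leq_add2l.
Qed.

Lemma min_nat_eq (A : set nat) n :
  A n -> (forall m, A m -> (n <= m)%N) -> min_nat A = n.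
Proof.
move=> An nmin; have [|Am mmin] := @min_natP A; first by exists n.
by apply/eqP; rewrite eqn_leq mmin //= nmin.
Qed.

(** Every nontrivial element of a factor is one of the generators, so the normal form is itself a
    word in them. Conversely the size of the normal form is subadditive and is 1 on each
    generator. *)
Lemma word_lengthE (g : G) : word_length g = size (fp_word g).
Proof.
apply: min_nat_eq.
  pose F (x : 'Z_2 + 'Z_3) : G :=
    match x with inl h => fp_inl 'Z_3 h | inr h => fp_inr 'Z_2 h end.
  have letter x : ~~ fp_triv x -> F x \in [:: a; b; b^-1].
    by case: x => -[[|[|[|m]]] lt].
  exists [seq F x | x <- fp_word g]; last by rewrite size_map.
  split; last by rewrite big_map -fp_prodE.
  have /andP[/allP tg _] := fp_wordP g.
  by move=> x /mapP[y /tg ty ->]; apply: letter.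
move=> _ [w [ws <-] <-]; elim: w ws => [|x w IHw] ws; first by rewrite big_nil.
rewrite big_cons; apply: leq_trans (size_fp_wordM _ _) _.
rewrite -[size (x :: w)]add1n leq_add //; last first.
  by apply: IHw => y yw; apply: ws; rewrite inE yw orbT.
by have := ws x (mem_head _ _); rewrite !inE => /or3P[] /eqP->.
Qed.

(* If h = g ^ u then g^N = u h^N u^-1, so the length N * 2|s| of g^N is at    *)
(* most 2|u| + N|h| for all N, which forces 2|s| <= |h|.                      *)
Lemma class_length_ab_prod s :
  class_length (conj_class (ab_prod s)) = (2 * size s)%N.
Proof.
have sz t : size (fp_word (ab_prod t)) = (2 * size t)%N.
  by rewrite fp_word_ab_prod size_ab_word.
apply: min_nat_eq.
  exists (ab_prod s); last by rewrite word_lengthE sz.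
  by exists 1; rewrite //= conjg1.
move=> _ [_ [u _ <-] <-]; rewrite word_lengthE leqNgt; apply/negP => lt.
(* If |h| < 2|s|, then N * 2|s| <= 2|u| + N * (2|s| - 1), that is N <= 2|u|; the least N
   contradicting this is taken. *)
set h := ab_prod s ^ u in lt; pose N := (size (fp_word u)).*2.+1.
have eN : ab_prod s ^+ N = u * (h ^+ N * u^-1).
  by rewrite -conjXg /conjg !mulgA mulgV mul1g mulgK.
have := size_fp_wordM u (h ^+ N * u^-1).
rewrite -eN; have := size_fp_wordM (h ^+ N) u^-1; have := size_fp_wordX h N.
rewrite size_fp_wordV ab_prodX sz size_flatten /shape map_nseq sumn_nseq.
have := leq_mul (leqnn N) lt; rewrite -/N mulnS mulnCA (mulnC N (size s)).
move: (N * size h)%N (size s * N)%N => k l.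
move: (size (fp_word (h ^+ N * _))) (size (fp_word (h ^+ N))) => i j.
rewrite /N; move: (size (fp_word u)) => d; clear; lia.
Qed.

Lemma ab_prod_conj_rot s n : conj_class (ab_prod (rot n s)) = conj_class (ab_prod s).
Proof.
have sub (g h : G) : conj_class (g ^ h) = conj_class g.
  apply/seteqP; split=> _ [u _ <-].
    by exists (h * u); rewrite //= conjgM.
  by exists (h^-1 * u); rewrite //= -conjgM mulKVg.
rewrite -[in RHS](cat_take_drop n s) /rot !ab_prod_cat.
by rewrite -(sub (ab_prod (take n s) * _) (ab_prod (take n s))) /conjg -mulgA mulKg.
Qed.

(** If [s] is no longer than [p], it is a prefix of [p] and can be cancelled, which shortens [p]
    unless [s] is empty. Otherwise [p] is a prefix of [s], say s = p q, and then s' = q p. *)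
Lemma cat_commute_rot (T : Type) (p s s' : seq T) :
  s ++ p = p ++ s' -> exists n, s' = rot n s.
Proof.
have [m] := ubnP (size p); elim: m p => // m IHm p ltpm e.
case: s => [|x s] in IHm e *.
  exists 0; rewrite rot0; apply/size0nil/eqP; move/(congr1 size)/eqP: e.
  by rewrite !size_cat add0n -{1}[size p]addn0 eqn_add2l eq_sym.
have sz : size s' = size (x :: s).
  by apply/eqP; rewrite -(eqn_add2l (size p)) -!size_cat -e !size_cat addnC.
have [le|gt] := leqP (size (x :: s)) (size p).
  have ep : p = (x :: s) ++ drop (size (x :: s)) p.
    rewrite -{1}(cat_take_drop (size (x :: s)) p); congr (_ ++ _).
    by move/(congr1 (take (size (x :: s)))): e; rewrite take_size_cat // takel_cat.
  apply: (IHm (drop (size (x :: s)) p)).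
    by rewrite size_drop; move: ltpm le => /=; lia.
  move: e; rewrite {1 2}ep -catA => /(congr1 (drop (size (x :: s)))).
  by rewrite !drop_size_cat.
exists (size p); rewrite /rot.
move/(congr1 (take (size p))): (e); rewrite takel_cat ?(ltnW gt) // take_size_cat // => ->.
move/(congr1 (drop (size p))): e; rewrite (@drop_size_cat _ _ p) // => <-.
by rewrite drop_cat gt.
Qed.

Lemma conj_class_eq (g h : G) :
  conj_class g = conj_class h <-> exists u, h = g ^ u.
Proof.
split=> [e|[u ->]]; last first.
  apply/seteqP; split=> _ [v _ <-].
    by exists (u^-1 * v); rewrite //= -conjgM mulKVg.
  by exists (u * v); rewrite //= conjgM.
have : conj_class h h by exists 1; rewrite //= conjg1.
by rewrite -e => -[u _ <-]; exists u.
Qed.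

(* If ab_prod s * u = u * ab_prod s', then v := (ab_prod s)^N * u also equals *)
(* u * (ab_prod s')^N. For N > |u| its normal form starts with a and ends     *)
(* with b^+-1, so that v = ab_prod p and s ++ p = p ++ s'.                    *)
Lemma ab_prod_conj (s s' : seq bool) : s != [::] -> s' != [::] ->
  conj_class (ab_prod s) = conj_class (ab_prod s') <-> exists n, s' = rot n s.
Proof.
move=> s0 s'0; split=> [/conj_class_eq[u us]|[n ->]]; last first.
  by rewrite ab_prod_conj_rot.
have e : ab_prod s * u = u * ab_prod s' by rewrite us /conjg mulKVg.
pose N := (size (fp_word u)).+1; pose v := ab_prod s ^+ N * u.
have vE : v = u * ab_prod s' ^+ N.
  by rewrite us -conjXg /conjg mulKVg.
have sz (t : seq bool) : t != [::] -> (N <= size (flatten (nseq N t)))%N.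
  case: t => // x t _; rewrite size_flatten /shape map_nseq sumn_nseq mulSn.
  exact: leq_addr.
have [y [w' last_v]] : exists y w', fp_word v = rcons w' (inr y).
  rewrite vE ab_prodX; move: (sz _ s'0).
  case/lastP: (flatten (nseq N s')) => [//|t x]; rewrite size_rcons ltnS => le.
  rewrite [fp_word _]/= fp_word_ab_prod.
  have -> : ab_word (rcons t x) = rcons (ab_word t) (inl 1%R) ++ [:: inr (b_sign x)].
    by rewrite /ab_word map_rcons flatten_rcons cat_rcons.
  have [|w1 -> _] := @fp_mulw_suffix _ _ (fp_word u)
    (rcons (ab_word t) (inl 1%R)) [:: inr (b_sign x)].
    by rewrite size_rcons size_ab_word; move: le; lia.
  by exists (b_sign x), w1; rewrite cats1.
have [x [w first_v]] : exists x w, fp_word v = inl x :: w.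
  (* [fp_mulw_suffix] controls only the right end of a product, so the first letter of [v] is read
     off as the last letter of its inverse. *)
  suff [x [w ew]] : exists x w, fp_word v^-1 = rcons w (inl x).
    exists x^-1, (fp_invw w).
    have -> : fp_word v = fp_invw (fp_word v^-1) by rewrite -[v in LHS]invgK.
    by rewrite ew /fp_invw map_rcons rev_rcons.
  rewrite /v invMg ab_prodX; move: (sz _ s0).
  case: (flatten (nseq N s)) => [//|x t]; rewrite /= ltnS => le.
  rewrite fp_word_ab_prod.
  have -> : fp_invw (ab_word (x :: t)) =
      rcons (fp_invw (ab_word t)) (inr (b_sign x)^-1) ++ [:: inl (1%R : 'Z_2)^-1].
    by rewrite /fp_invw /= !rev_cons cats1.
  have [|w1 -> _] := @fp_mulw_suffix _ _ (fp_invw (fp_word u))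
    (rcons (fp_invw (ab_word t)) (inr (b_sign x)^-1)) [:: inl (1%R : 'Z_2)^-1].
    rewrite size_rcons /fp_invw !size_rev !size_map size_ab_word.
    by move: le; lia.
  by exists (1%R : 'Z_2)^-1, w1; rewrite cats1.
have [p vp] := ab_prodP first_v last_v.
apply: (@cat_commute_rot _ p); apply: ab_prod_inj.
(* Both sides become [ab_prod s ^+ N.+1 * u]. *)
rewrite !ab_prod_cat -vp /v -(mulgA _ u) -e !mulgA.
by rewrite -expgS -expgSr.
Qed.

(** * Involutions and reciprocal words *)

Lemma has_order2P (G1 : groupType) (g : G1) :
  has_order g 2 <-> g * g = 1 /\ g <> 1.
Proof.
split=> [[_ gg g1]|[gg g1]].
  by split; [rewrite -expg2 | have := g1 1%N isT; rewrite expg1].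
split; rewrite ?expg2// => -[|[|m]] //.
Qed.

(** The normal form of an involution equals its formal inverse, so its first and last letters are
    mutually inverse. Peeling them off leaves a conjugate of [g], again an involution, with a
    shorter normal form. The descent ends at a single self-inverse letter, which can only be [a]. *)
Lemma involution_conj_a (g : G) : g * g = 1 -> g <> 1 -> exists u, g = a ^ u.
Proof.
pose F (x : 'Z_2 + 'Z_3) : G :=
  match x with inl h => fp_inl 'Z_3 h | inr h => fp_inr 'Z_2 h end.
have FV x : F (fp_invl x) = (F x)^-1.
  by apply: (mulIg (F x)); rewrite mulVg; case: x => h /=;
    rewrite -?fp_inlM -?fp_inrM mulVg ?fp_inl1 ?fp_inr1.
have Fsz w : (size (fp_word (\prod_(x <- w) F x)%g) <= size w)%N.
  elim: w => [|x w IHw]; first by rewrite big_nil.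
  rewrite big_cons; apply: leq_trans (size_fp_wordM _ _) _.
  rewrite -[size (x :: w)]add1n leq_add //.
  by case: x => h /=; rewrite /fp_push; case: ifP.
have [n] := ubnP (size (fp_word g)); elim: n g => // n IHn g ltn gg g1.
have gV : fp_word g = fp_invw (fp_word g).
  by rewrite -[RHS]/(fp_word g^-1); congr fp_word; apply: (mulgI g); rewrite gg mulgV.
have gF : g = \prod_(x <- fp_word g) F x by apply: fp_prodE.
have := fp_wordP g; move: gV ltn.
case: (fp_word g) gF => [|x w]; first by rewrite big_nil => /g1.
case/lastP: w => [|w y] gE.
  move: gE; rewrite big_seq1 => gx -[] ex _; rewrite /fp_reduced /= !andbT => x1.
  case: x => x in ex x1 gx *; last first.
    by case: ex x1; case: (b_signP x) => [->|[[] ->]].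
  by exists 1; rewrite conjg1 gx /a; case: (Z2_cases x) x1 => ->.
rewrite /fp_invw /= map_rcons rev_cons rev_rcons /= => -[xy _] ltn _.
pose h := \prod_(z <- w) F z.
have {}gE : g = h ^ (F x)^-1.
  by rewrite gE big_cons -cats1 big_cat big_seq1 -/h /conjg invgK xy FV invgK.
have [|||u hu] := IHn h.
- by apply: leq_ltn_trans (Fsz _) _; move: ltn; rewrite size_rcons; lia.
- by apply: (conjg_inj (F x)^-1); rewrite conjMg -gE gg conj1g.
- by move=> h1; apply: g1; rewrite gE h1 conj1g.
by exists (u * (F x)^-1); rewrite gE hu conjgM.
Qed.

Lemma conjg_a (g : G) : g ^ a = a * (g * a).
Proof. by apply: (mulgI a); rewrite -conjgC (mulgA a a) mulaa mul1g. Qed.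

(* ab_prod (antipal s) is the reciprocal word x a, where x is the conjugate   *)
(* of a by the inverse of ab_prod s.                                          *)
Definition antipal (s : seq bool) := s ++ rev (map negb s).

(** Inversion reverses the exponents and changes their signs, but puts each [a] to the right of its
    power of [b]; conjugation by [a] restores the alternation. *)
Lemma ab_prod_rev_negb s :
  ab_prod (rev (map negb s)) = a * ((ab_prod s)^-1 * a).
Proof.
elim: s => [|x s IHs]; first by rewrite /ab_prod big_nil invg1 mul1g mulaa.
rewrite /= rev_cons -cats1 ab_prod_cat IHs !ab_prod_cons !invMg inva -!mulgA.
rewrite mulaa (mulgA a a) mulaa mul1g mulg1 /ab_prod big_nil mulg1.
congr (_ * (_ * _)); apply: (mulIg (fp_inr 'Z_2 (b_sign x))).
by rewrite mulVg -fp_inrM b_signN mulVg fp_inr1.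
Qed.

Lemma ab_prod_antipal s :
  ab_prod (antipal s) = a ^ (ab_prod s)^-1 * a.
Proof. by rewrite ab_prod_cat ab_prod_rev_negb /conjg invgK !mulgA. Qed.

Lemma a_conj_order2 u : has_order (a ^ u) 2.
Proof.
apply/has_order2P; rewrite -conjMg mulaa conj1g; split=> // /(congr1 (conjg^~ u^-1)).
by rewrite -conjgM mulgV conjg1 conj1g.
Qed.

(** With x = a^u and y = a^v, the product is conjugate to a^(u v^-1) a. In the normal form of (u
    v^-1)^-1 a final [a] centralises [a] and may be dropped, and an initial power of [b] is absorbed
    after conjugating by [a]. The word is nonempty because x and y differ. *)
Lemma R_classesE : R_classes =
  (fun s => conj_class (ab_prod (antipal s))) @` [set s | s != [::]].
Proof.
apply/seteqP; split=> [_ [_ [x [y [nxy + + ->]]] <-]|_ [s /= s0 <-]]; last first.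
  exists (ab_prod (antipal s)) => //.
  exists (a ^ (ab_prod s)^-1), (a ^ 1); split; rewrite ?conjg1.
  - move=> e; have := ab_prod_antipal s; rewrite e mulaa => /(congr1 (@fp_word _ _)).
    by rewrite fp_word_ab_prod; case: s s0 {e}.
  - exact: a_conj_order2.
  - exact: a_order.
  - exact: ab_prod_antipal.
move=> /has_order2P[xx x1] /has_order2P[yy y1].
have [u ux] := involution_conj_a xx x1; have [v vy] := involution_conj_a yy y1.
have [z [s [z' ez]]] := ab_normal_form (u * v^-1)^-1.
have exy : x * y = (a ^ (fp_inr 'Z_2 z * ab_prod s)^-1 * a) ^ v.
  have -> : a ^ (fp_inr 'Z_2 z * ab_prod s)^-1 = a ^ (u * v^-1).
    rewrite -[u * _]invgK ez mulgA [in RHS]invMg conjgM; congr (_ ^ _).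
    case: (Z2_cases z') => ->; first by rewrite fp_inl1 invg1 conjg1.
    by rewrite -/a /conjg invgK mulgV mulg1.
  by rewrite conjMg -conjgM mulgKV -ux -vy.
have [s' es'] : exists s', conj_class (x * y) = conj_class (ab_prod (antipal s')).
  case: (b_signP z) exy => [->|[e ->]] exy.
    exists s; apply/esym/conj_class_eq; exists v.
    by rewrite exy ab_prod_antipal fp_inr1 mul1g.
  (* Conjugation by [a] takes (a k) a (a k)^-1 a to k a k^-1 a; here k is b^e times [ab_prod s]. *)
  exists (e :: s); apply/esym/conj_class_eq; exists (a * v); rewrite exy conjgM.
  congr (_ ^ _); rewrite ab_prod_antipal conjg_a ab_prod_cons /conjg !invgK (invMg a) inva.
  by rewrite -!mulgA mulaa mulg1 (mulgA a a) mulaa mul1g.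
exists s' => //=; apply: contra_not_neq nxy => s'0.
move/esym/conj_class_eq: es' => [w].
rewrite s'0 /antipal /ab_prod big_nil conj1g => xy1.
by apply: (mulIg y); rewrite yy.
Qed.

(** * Counting *)

Lemma card_eq_finset (T : finType) (A : {set T}) : ([set` A] #= `I_#|A|)%card.
Proof.
have [->|[x xA]] := set_0Vmem A.
  rewrite cards0 II0 card_eq0; apply/eqP/seteqP; split=> x //=.
  by rewrite finset.in_set0.
rewrite (_ : [set` A] = nth x (enum A) @` `I_#|A|).
  apply: inj_card_eq => i j; rewrite !inE => iA jA /eqP.
  by rewrite nth_uniq -?cardE ?enum_uniq // => /eqP.
apply/seteqP; split=> [y /= yA|_ [i /= iA <-]].
  by exists (index y (enum A)); rewrite /= ?nth_index ?cardE ?index_mem ?mem_enum.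
by rewrite -mem_enum mem_nth // -cardE.
Qed.

Lemma R_eqE k : (0 < k)%N -> R_eq (4 * k) =
  (fun t => conj_class (ab_prod (val t))) @` [set` antipal_necklaces k].
Proof.
move=> k0; have froot_conj (t : (k + k).-tuple bool) :
    conj_class (ab_prod (froot (@rot1_tuple _) t)) = conj_class (ab_prod t).
  have [n ->] := (fconnect_rot1_tuple t _).1 (connect_root _ t).
  exact: ab_prod_conj_rot.
have len s : class_length (conj_class (ab_prod (antipal s))) = (4 * size s)%N.
  rewrite class_length_ab_prod size_cat size_rev size_map addnn -mul2n.
  by rewrite mulnA.
apply/seteqP; split=> [C []|_ [y /= /imsetP[t + ->] <-]].
  rewrite R_classesE => -[s /= s0 <-]; rewrite len => /eqP.
  rewrite eqn_pmul2l // => sz; pose t := antipal_tuple (Tuple sz).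
  exists (froot (@rot1_tuple _) t); last by rewrite froot_conj.
  by apply/imsetP; exists t => //; rewrite rev_negb_fixedE imset_f.
rewrite rev_negb_fixedE => /imsetP[u _ ->]; rewrite froot_conj; split; last first.
  by rewrite [LHS]len size_tuple.
rewrite R_classesE; exists (val u) => //=.
by rewrite -size_eq0 size_tuple -lt0n.
Qed.

(** The parametrisation of [R_eqE] is injective: conjugate representatives are rotations of each
    other, and each orbit has only one root. *)
Lemma card_R_eq k : (0 < k)%N -> (R_eq (4 * k) #= `I_(2 ^ (k - 1)))%card.
Proof.
move=> k0; rewrite R_eqE // -card_antipal_necklaces //.
apply: card_eq_trans (card_eq_finset _); apply: inj_card_eq.
move=> y y'; rewrite !inE /= => /imsetP[t _ ->] /imsetP[t' _ ->].
have nnil (u : (k + k).-tuple bool) : val u != [::].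
  by rewrite -size_eq0 size_tuple addnn double_eq0 -lt0n.
move=> /(ab_prod_conj (nnil _) (nnil _)) /fconnect_rot1_tuple.
have sym := fconnect_sym (@rot1_tuple_inj (k + k)).
by rewrite -root_connect // !(root_root sym) => /eqP.
Qed.

Lemma card_eqU (T : choiceType) (A B : set T) m n :
  (A #= `I_m)%card -> (B #= `I_n)%card -> A `&` B = set0 ->
  (A `|` B #= `I_(m + n))%card.
Proof.
move=> Am Bn AB.
have fA : finite_set A by exists m.
have fB : finite_set B by exists n.
rewrite -(@fset_setK _ (A `|` B)); last by rewrite finite_setU.
apply/card_eq_fsetP.
rewrite fset_setU // finmap.cardfsU -fset_setI // AB fset_set0 finmap.cardfs0 subn0.
by rewrite (card_fset_set Am) (card_fset_set Bn).
Qed.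

(** All lengths are positive multiples of 4, so passing from t to t + 1 adds exactly the 2^t classes
    of length 4(t + 1), and for t = 0 there are none. *)
Lemma card_R_le t : (R_le (4 * t) #= `I_(2 ^ t - 1))%card.
Proof.
have len C : R_classes C -> exists2 k, (0 < k)%N & class_length C = (4 * k)%N.
  rewrite R_classesE => -[s /= s0 <-]; exists (size s).
    by rewrite lt0n size_eq0.
  rewrite class_length_ab_prod size_cat size_rev size_map addnn -mul2n.
  by rewrite mulnA.
elim: t => [|t IHt].
  rewrite (_ : R_le _ = set0); first by rewrite subnn II0 card_eq00.
  by apply/seteqP; split=> C // -[/len[k k0 ->]]; rewrite leqNgt muln_gt0 k0.
have -> : (2 ^ t.+1 - 1 = 2 ^ t - 1 + 2 ^ (t.+1 - 1))%N.
  by rewrite subn1 /= expnS subSS subn0; have := expn_gt0 2 t; lia.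
rewrite (_ : R_le _ = R_le (4 * t) `|` R_eq (4 * t.+1)).
  apply: card_eqU => //; first exact: card_R_eq.
  apply/seteqP; split=> C // -[[_ le] [_ e]].
  by move: le; rewrite e leq_pmul2l // ltnn.
apply/seteqP; split=> C.
  move=> [RC]; have [k _ e] := len C RC.
  rewrite e leq_pmul2l // leq_eqVlt ltnS => /predU1P[kt|le].
    by right; split=> //; rewrite e kt.
  by left; split=> //; rewrite e leq_pmul2l.
by move=> [[RC le]|[RC e]]; split=> //; rewrite ?e //; apply: leq_trans le _;
  rewrite leq_pmul2l.
Qed.

Theorem lemma5p1 (t : nat) (ht : (0 < t)%N) :
  (R_eq (4 * t) #= `I_(2 ^ (t - 1)))%card /\
  (R_le (4 * t) #= `I_(2 ^ t - 1))%card.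
Proof. by split; [exact: card_R_eq | exact: card_R_le]. Qed.
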